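(* Let $f,g,h$ be symmetrically decreasing functions on $\mathbb R$ with $0\leq g\leq 1$ and $\int_{\mathbb R} g(x)\,dx=1$, and let $M_1=\mathbf 1_{(-1/2,1/2)}$. Then $$\int_{\mathbb R} h(x)\,(f*g)(x)\,dx\leq\int_{\mathbb R} h(x)\,(f*M_1)(x)\,dx.$$ Moreover, if $f$ is not constant almost everywhere and $f*g\in L_1(\mathbb R)$, then equality in this inequality for all symmetrically decreasing functions $h$ implies that $g=M_1$ almost everywhere.
   Context: A function $f:\mathbb R\to[0,\infty]$ is called symmetrically decreasing if $f(-x)=f(x)$ for all $x\in\mathbb R$ and $f(y)\leq f(x)$ for all $0<x<y$. The convolution of non-negative functions is $(f*g)(x)=\int_{\mathbb R} f(x-y)g(y)\,dy\in[0,\infty]$. $\mathbf 1_A$ denotes the indicator function of the set $A$. Integrals are with respect to Lebesgue measure and take values in $[0,\infty]$. *)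

(* Defs.v *)
From mathcomp Require Import all_boot all_order all_algebra.
From mathcomp Require Import all_classical all_reals all_analysis.
Set Implicit Arguments.
Unset Strict Implicit.
Unset Printing Implicit Defensive.
Import Order.TTheory GRing.Theory Num.Theory.
Import numFieldNormedType.Exports.
Local Open Scope classical_set_scope.
Local Open Scope ring_scope.
Local Open Scope ereal_scope.

(* The value at 0 is unconstrained: monotonicity is only required on the open
   half-line.  Measurability is not assumed, since it follows. *)
Definition symmetrically_decreasing (R : realType) (f : R -> \bar R) : Prop :=
  [/\ forall x : R, 0 <= f x,
      forall x : R, f (- x)%R = f x
    & forall x y : R, (0 < x)%R -> (x < y)%R -> f y <= f x].

(* Meant for nonnegative functions; products use the convention 0 * +oo = 0. *)
Definition convolution (R : realType) (f g : R -> \bar R) (x : R) : \bar R :=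
  \int[lebesgue_measure]_(y in setT) (f (x - y)%R * g y).

Definition M1 (R : realType) (x : R) : \bar R :=
  (\1_(`](- 2^-1)%R, (2^-1)%R[%classic : set R) x)%:E.

Definition ae_constant (R : realType) (f : R -> \bar R) : Prop :=
  exists c : \bar R, {ae lebesgue_measure, forall x : R, f x = c}.

(* Main.v *)
Require Import Defs.
From mathcomp Require Import all_boot all_order all_algebra.
From mathcomp Require Import all_classical all_reals all_analysis.
From mathcomp Require Import measurable_realfun lra ring.
Import Order.TTheory GRing.Theory Num.Theory.
Import numFieldNormedType.Exports.
Local Open Scope classical_set_scope.
Local Open Scope ring_scope.
Local Open Scope ereal_scope.

(** The kernel [correlation h f y], the integral of [h x * f (x - y)] in [x],
    turns both sides of the inequality into weighted averages: by Tonelli,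
    [h] paired with [f * u] is [u] paired with [correlation h f], for [u = g]
    as well as for [u = M1] ([integral_mul_convolution]).

    The kernel is again nonincreasing in the distance to [0]
    ([correlation_radial]).  To compare its values at [0 <= y < z], fold the
    integral along the reflection [x |-> y + z - x], which swaps [y] and [z].
    On the half-line that is nearer to [y], the two integrands become
    [a b + a' b'] and [a b' + a' b] with [a' <= a] and [b' <= b], and their
    difference is [(a - a') (b - b') >= 0].

    Among the densities bounded by [1] and of mass [1], the average of such a
    kernel [K] is largest for the one that sits where [K] is largest, which is
    [M1].  This is the bathtub principle; its quantitative form, with
    [c = K (1/2)], is the identity ([bathtub_identity])

      int g K + int |M1 - g| |K - c| = int M1 K.

    For the equality case, a single strictly decreasing bounded weight is
    enough, here [h x = 1 / (1 + |x|)].  Pairing with the constant weight [1]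
    shows that [f] has the same integral as [f * g], so that [f] is integrable
    and [K] is finite.  If [K y = K z] for some [0 <= y < z], the folded
    difference vanishes almost everywhere; since [h] is strictly decreasing,
    [f s = f (s + (z - y))] for almost every [s > 0], which forces the monotone
    function [f] to be constant.  Hence [K] is strictly decreasing
    ([correlation_strict]), [K - c] vanishes only at [1/2] and [-1/2], and the
    identity above leaves [g = M1] almost everywhere ([bathtub_eq]).

    The value of a symmetrically decreasing function at [0] is arbitrary.
    Raising it to [+oo] ([raise0]) changes no integral and makes the function
    monotone in [|x|] on the whole line. *)

(** * Lebesgue integrals under reflection *)

Section lebesgue.
Set Implicit Arguments.
Unset Strict Implicit.
Context {R : realType}.
Local Notation mu := (@lebesgue_measure R).
Implicit Types (phi psi : R -> \bar R) (c p : R).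

Lemma measurable_subrl c : measurable_fun [set: R] (fun x : R => c - x)%R.
Proof. exact: measurable_funB. Qed.

(** A measure on the Borel sets is determined by its values on half-open
    intervals; a reflected interval differs only by its end points. *)
Lemma lebesgue_measure_reflect c (A : set R) : measurable A ->
  mu A = pushforward mu (fun x : R => c - x)%R A.
Proof.
move=> mA.
have mc := measurable_subrl c.
pose nu : {measure set (measurableTypeR R) -> \bar R} :=
  measure_function_pushforward__canonical__measure_function_Measure mu
    (mc : measurable_fun [set: measurableTypeR R]
            ((fun x : R => c - x)%R : _ -> measurableTypeR R)).
suff muE X : ocitv X -> mu X = nu X by exact: (lebesgue_measure_unique muE).
move=> [[a b] _ <-]; rewrite /nu /= /pushforward.
have -> : (fun x : R => (c - x)%R) @^-1` `]a, b]%classic = `[(c - b)%R, (c - a)%R[%classic.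
  by apply/seteqP; split=> x /=; rewrite !in_itv/= => /andP[? ?]; apply/andP; split; lra.
rewrite !lebesgue_measure_itv/= !lte_fin ltrD2l ltrN2.
by case: ifP => // _; rewrite -!EFinB; congr EFin; lra.
Qed.

Lemma ge0_integral_reflect c (D : set R) phi : measurable D ->
  measurable_fun [set: R] phi -> (forall x, 0 <= phi x) ->
  \int[mu]_(x in D) phi x =
  \int[mu]_(x in (fun x : R => c - x)%R @^-1` D) phi (c - x)%R.
Proof.
move=> mD mphi phi0.
have mc := measurable_subrl c.
rewrite -(@ge0_integral_pushforward _ _ (measurableTypeR R) (measurableTypeR R)
  _ _ mc mu _ _ mD (measurable_funTS mphi)) //.
by apply: eq_measure_integral => A mA _; exact: lebesgue_measure_reflect.
Qed.

(** The reflection [x |-> m - x] exchanges the two half-lines cut at [m / 2]. *)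
Lemma ge0_integral_fold m phi : measurable_fun [set: R] phi ->
  (forall x, 0 <= phi x) ->
  \int[mu]_x phi x =
  \int[mu]_(x in `]-oo, (m / 2)%R[) (phi x + phi (m - x)%R).
Proof.
move=> mphi phi0.
rewrite ge0_integralD//; last 2 first.
- exact: measurable_funTS.
- by apply: measurable_funTS; apply: measurableT_comp => //; exact: measurable_subrl.
have -> : `]-oo, (m / 2)%R[%classic =
    (fun x : R => m - x)%R @^-1` `](m / 2)%R, +oo[%classic :> set R.
  by apply/seteqP; split=> x /=; rewrite !in_itv/= ?andbT => ?; lra.
rewrite -ge0_integral_reflect// integral_itv_obnd_cbnd; last exact: measurable_funTS.
have -> : (fun x : R => m - x)%R @^-1` `](m / 2)%R, +oo[%classic =
    `]-oo, (m / 2)%R[%classic :> set R.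
  by apply/seteqP; split=> x /=; rewrite !in_itv/= ?andbT => ?; lra.
rewrite -ge0_integral_setU//.
- congr integral; apply/esym/seteqP; split=> x //= _; rewrite !in_itv/= andbT.
  by case: (ltP x (m / 2)%R) => ?; [left|right].
- exact: measurable_funTS.
- apply/disj_setPRL => x /=; rewrite !in_itv/= andbT => ?; apply/negP.
  by rewrite -leNgt.
Qed.

Lemma integral_eq_off_point p phi psi : measurable_fun [set: R] phi ->
  measurable_fun [set: R] psi -> (forall x, x != p -> phi x = psi x) ->
  \int[mu]_x phi x = \int[mu]_x psi x.
Proof.
move=> mphi mpsi e; have mp : measurable ([set: R] `\ p) by exact: measurableD.
rewrite -(integral_setD1 mp (measurable_funTS mphi)).
rewrite -(integral_setD1 mp (measurable_funTS mpsi)).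
by apply: eq_integral => x; rewrite inE => -[_ /= /eqP xp]; exact: e.
Qed.

Lemma ae_itvoo_ex (P : set R) (a b : R) : {ae mu, forall x, P x} -> (a < b)%R ->
  exists x : R, [/\ (a < x)%R, (x < b)%R & P x].
Proof.
move=> [N [mN N0 PN]] ab; apply: contrapT => nex.
have sub : `]a, b[%classic `<=` N.
  move=> x /=; rewrite in_itv/= => /andP[ax xb]; apply: PN => Px.
  by apply: nex; exists x.
have : mu `]a, b[%classic = 0 by apply: (subset_measure0 _ mN sub N0).
rewrite lebesgue_measure_itv/= lte_fin ab -EFinB => -[]; lra.
Qed.

Lemma filter_ae_lebesgue : Filter (almost_everywhere mu).
Proof. exact: (@ae_filter_ringOfSetsType _ (measurableTypeR R) R mu). Qed.

Lemma ae_neq p : {ae mu, forall x : R, x != p}.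
Proof.
exists [set p]; split => //; first exact: lebesgue_measure_set1.
by move=> x /= /negP; rewrite negbK => /eqP.
Qed.

Lemma ge0_integral0_ae (D : set R) phi : measurable D -> measurable_fun D phi ->
  (forall x, D x -> 0 <= phi x) -> \int[mu]_(x in D) phi x = 0 ->
  {ae mu, forall x, D x -> phi x = 0}.
Proof.
move=> mD mphi phi0 i0; apply/ae_eq_integral_abs => //.
by rewrite -[RHS]i0; apply: eq_integral => x; rewrite inE => Dx; rewrite gee0_abs ?phi0.
Qed.

End lebesgue.

(** * Functions that are nonincreasing in the absolute value *)

Section radial.
Set Implicit Arguments.
Unset Strict Implicit.
Context {R : realType}.
Local Notation mu := (@lebesgue_measure R).
Implicit Types (f g h : R -> \bar R) (x y z : R).

Definition radially_nonincreasing f :=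
  forall x y, (`|x| <= `|y|)%R -> f y <= f x.

(** The value [+oo] is the only one at [0] that dominates all others whatever
    [f] is; a single point has measure zero. *)
Definition raise0 f x : \bar R := if (x == 0)%R then +oo else f x.

Lemma raise0_radial f :
  symmetrically_decreasing f -> radially_nonincreasing (raise0 f).
Proof.
move=> [_ fN fdecr] x y xy; rewrite /raise0.
have [_|x0] := eqVneq x 0%R; first by rewrite leey.
have [y0|y0] := eqVneq y 0%R.
  by move: xy; rewrite y0 normr0 normr_le0 (negbTE x0).
have fnorm t : f `|t|%R = f t by case: (ger0P t) => _ //; rewrite fN.
rewrite -(fnorm x) -(fnorm y); move: xy; rewrite le_eqVlt => /predU1P[->//|].
by apply: fdecr; rewrite normr_gt0.
Qed.

Lemma raise0_ge0 f : (forall x, 0 <= f x) -> forall x, 0 <= raise0 f x.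
Proof. by move=> f0 x; rewrite /raise0; case: ifP. Qed.

(** The superlevel sets are intervals, because they are closed under passing
    to points that are closer to the origin. *)
Lemma radial_measurable f :
  radially_nonincreasing f -> measurable_fun [set: R] f.
Proof.
move=> rf mT; apply: (measurability _ (ErealGenOInfty.measurableE R)) => //.
move=> /= _ [_ [a ->] <-]; rewrite preimage_itvoy setTI.
apply: is_interval_measurable => x y /= ax ay z /andP[xz zy].
have [zx|xz'] := leP `|z|%R `|x|%R; first exact: lt_le_trans (rf _ _ zx).
apply: (lt_le_trans ay); apply: rf.
have [x0|x0] := ger0P x; have [z0|z0] := ger0P z; move: xz'.
- rewrite (ger0_norm x0) (ger0_norm z0) => _; have y0 := le_trans z0 zy.
  by rewrite ger0_norm.
- by have := le_lt_trans (le_trans x0 xz) z0; rewrite ltxx.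
- by move=> _; rewrite (ger0_norm (le_trans z0 zy)).
- by rewrite (ltr0_norm z0) (ltr0_norm x0) ltrN2 => /(le_lt_trans xz); rewrite ltxx.
Qed.

Lemma raise0_eq f x : x != 0%R -> raise0 f x = f x.
Proof. by rewrite /raise0 => /negbTE ->. Qed.

Lemma symmetrically_decreasing_measurable f :
  symmetrically_decreasing f -> measurable_fun [set: R] f.
Proof.
move=> hf.
rewrite (_ : f = fun x => if x == 0%R then f 0%R else raise0 f x); last first.
  by apply/funext => x; rewrite /raise0; case: eqP => // ->.
apply: measurable_fun_ifT => //; last first.
  exact: radial_measurable (raise0_radial hf).
exact: measurable_fun_eqr.
Qed.

Lemma convolution_raise0 f g : symmetrically_decreasing f ->
  measurable_fun [set: R] g -> convolution f g = convolution (raise0 f) g.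
Proof.
move=> hf mg; apply/funext => x.
apply: (integral_eq_off_point (p := x)).
- apply: emeasurable_funM => //; apply: measurableT_comp; last exact: measurable_subrl.
  exact: symmetrically_decreasing_measurable.
- apply: emeasurable_funM => //; apply: measurableT_comp; last exact: measurable_subrl.
  exact: radial_measurable (raise0_radial hf).
- by move=> y yx; rewrite raise0_eq// subr_eq0 eq_sym.
Qed.

(** * The correlation kernel *)

(** For even [f] this is the convolution of [h] and [f].  Keeping [f (x - y)]
    lets Tonelli apply without any symmetry. *)
Definition correlation h f y : \bar R := \int[mu]_x (h x * f (x - y)%R).

Lemma measurable_shift f y : measurable_fun [set: R] f ->
  measurable_fun [set: R] (fun x => f (x - y)%R).
Proof. by move=> mf; apply: measurableT_comp => //; exact: measurable_funB. Qed.

Section pairing.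
Variables (f g h : R -> \bar R).
Hypotheses (mf : measurable_fun [set: R] f) (mg : measurable_fun [set: R] g).
Hypothesis mh : measurable_fun [set: R] h.
Hypotheses (f0 : forall x, 0 <= f x) (g0 : forall x, 0 <= g x).
Hypothesis h0 : forall x, 0 <= h x.

Lemma measurable_diff2 :
  measurable_fun [set: R * R] (fun p : R * R => f (p.1 - p.2)%R).
Proof. by apply: measurableT_comp => //; apply: measurable_funB. Qed.

Lemma correlation_ge0 y : 0 <= correlation h f y.
Proof. by apply: integral_ge0 => x _; exact: mule_ge0. Qed.

Lemma measurable_convolution : measurable_fun [set: R] (convolution f g).
Proof.
apply: (@measurable_fun_fubini_tonelli_F _ _ (measurableTypeR R)
  (measurableTypeR R) R mu (fun p : R * R => f (p.1 - p.2)%R * g p.2)) => /=.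
- by apply: emeasurable_funM; [exact: measurable_diff2|exact: measurableT_comp].
- by move=> p; exact: mule_ge0.
Qed.

Lemma convolution_ge0 x : 0 <= convolution f g x.
Proof. by apply: integral_ge0 => y _; exact: mule_ge0. Qed.

Lemma integral_mul_convolution :
  \int[mu]_x (h x * convolution f g x) = \int[mu]_y (g y * correlation h f y).
Proof.
transitivity (\int[mu]_x \int[mu]_y (h x * (f (x - y)%R * g y))).
  apply: eq_integral => x _; rewrite -ge0_integralZl//.
  - apply: emeasurable_funM => //; apply: measurableT_comp => //.
    exact: measurable_subrl.
  - by move=> y _; exact: mule_ge0.
rewrite (@fubini_tonelli _ _ (measurableTypeR R) (measurableTypeR R) R mu mu
  (fun p : R * R => h p.1 * (f (p.1 - p.2)%R * g p.2))) /=.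
- apply: eq_integral => y _; rewrite -ge0_integralZl//.
  + by apply: eq_integral => x _; rewrite muleA muleC.
  + by apply: emeasurable_funM => //; apply: measurable_shift mf.
  + by move=> x _; exact: mule_ge0.
- apply: emeasurable_funM; first exact: measurableT_comp.
  by apply: emeasurable_funM; [exact: measurable_diff2|exact: measurableT_comp].
- by move=> p; rewrite !mule_ge0.
Qed.

End pairing.

Lemma radialN f : radially_nonincreasing f -> forall x, f (- x)%R = f x.
Proof. by move=> rf x; apply/eqP; rewrite eq_le !rf ?normrN. Qed.

(** * Monotonicity of the kernel *)

(** Finiteness is asked of the smaller values only: then [a] and [b] are sums
    of two nonnegative terms, and the product distributes over these even when
    a term is infinite. *)
Lemma two_point_identity (a a' b b' : \bar R) :
  a' \is a fin_num -> b' \is a fin_num -> 0 <= a' -> 0 <= b' -> a' <= a -> b' <= b ->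
  a * b + a' * b' = (a * b' + a' * b) + (a - a') * (b - b').
Proof.
move=> a'fin b'fin a'0 b'0 a'a b'b.
have [e e0 ->] : exists2 e, 0 <= e & a = e + a'.
  by exists (a - a'); rewrite ?subeK// sube_ge0// a'fin.
have [d d0 ->] : exists2 d, 0 <= d & b = d + b'.
  by exists (b - b'); rewrite ?subeK// sube_ge0// b'fin.
rewrite !addeK//.
rewrite !(ge0_muleDl, ge0_muleDr)// ?adde_ge0//.
by rewrite [LHS]addeAC -(addeA (e * d)) [RHS]addeC [in RHS]addeA.
Qed.

Lemma two_point_rearrangement (a a' b b' : \bar R) :
  0 <= a' -> 0 <= b' -> a' <= a -> b' <= b -> a * b' + a' * b <= a * b + a' * b'.
Proof.
have infE (u v : \bar R) : 0 <= v -> v <= u -> ~ v \is a fin_num -> u = v.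
  by case: v => // _; rewrite leye_eq => /eqP.
move=> a'0 b'0 a'a b'b.
have [a'fin|/negP/(infE _ _ a'0 a'a) ->] := boolP (a' \is a fin_num); last first.
  by rewrite addeC.
have [b'fin|/negP/(infE _ _ b'0 b'b) ->//] := boolP (b' \is a fin_num).
by rewrite [leRHS]two_point_identity// leeDl// mule_ge0// sube_ge0// ?a'fin ?b'fin.
Qed.

(** Both facts say that [x] lies on the side of the midpoint that contains [y]
    and, since [0 <= y < z], the origin. *)
Lemma fold_dist (x y z : R) : (0 <= y)%R -> (y < z)%R -> (x < (y + z) / 2)%R ->
  (`|x - y| < `|x - z|)%R /\ (`|x| < `|y + z - x|)%R.
Proof.
move=> y0 yz xm; split.
  rewrite (@ltr0_norm _ (x - z)%R); last by lra.
  by rewrite ltr_norml; apply/andP; split; lra.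
rewrite (@gtr0_norm _ (y + z - x)%R); last by lra.
by rewrite ltr_norml; apply/andP; split; lra.
Qed.

Section correlation_radial.
Variables (f h : R -> \bar R).
Hypotheses (rf : radially_nonincreasing f) (rh : radially_nonincreasing h).
Hypotheses (f0 : forall x, 0 <= f x) (h0 : forall x, 0 <= h x).

Let mf := radial_measurable rf.
Let mh := radial_measurable rh.

Lemma correlationN y : correlation h f (- y)%R = correlation h f y.
Proof.
rewrite /correlation [RHS](ge0_integral_reflect 0%R)//.
- rewrite preimage_setT; apply: eq_integral => x _.
  rewrite sub0r radialN// -[in RHS](radialN rf); congr (_ * f _).
  by lra.
- by apply: emeasurable_funM => //; exact: measurable_shift.
- by move=> x; exact: mule_ge0.
Qed.

(** The reflection about the midpoint of [y] and [z] sends [x - y] to [z - x],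
    and [f] is even. *)
Lemma correlation_fold y z : correlation h f y =
  \int[mu]_(x in `]-oo, ((y + z) / 2)%R[)
    (h x * f (x - y)%R + h (y + z - x)%R * f (x - z)%R).
Proof.
rewrite /correlation (ge0_integral_fold (y + z)%R).
- apply: eq_integral => x _; congr (_ + _ * _).
  by rewrite -(radialN rf); congr f; lra.
- by apply: emeasurable_funM => //; exact: measurable_shift.
- by move=> x; exact: mule_ge0.
Qed.

Lemma measurable_folded c y z : measurable_fun [set: R]
  (fun x => h x * f (x - y)%R + h (c - x)%R * f (x - z)%R).
Proof.
apply: emeasurable_funD; apply: emeasurable_funM.
- exact: mh.
- exact: measurable_shift mf.
- exact: measurableT_comp mh (measurable_subrl c).
- exact: measurable_shift mf.
Qed.

Lemma correlation_radial : radially_nonincreasing (correlation h f).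
Proof.
have cabs x : correlation h f `|x|%R = correlation h f x.
  by case: (ger0P x) => // _; rewrite correlationN.
move=> y' z'; rewrite -(cabs y') -(cabs z').
have : (0 <= `|y'|)%R by [].
generalize (`|y'|%R) (`|z'|%R) => y z y0; rewrite le_eqVlt => /predU1P[->//|yz].
rewrite (correlation_fold y z) (correlation_fold z y) (addrC z y).
apply: ge0_le_integral => //.
- by move=> x _; rewrite adde_ge0 ?mule_ge0.
- by apply: measurable_funTS; exact: measurable_folded.
- by apply: measurable_funTS; exact: measurable_folded.
- move=> x; rewrite /= in_itv/= => xm.
  have [/ltW xyz /ltW xs] := fold_dist y0 yz xm.
  by apply: two_point_rearrangement => //; [exact: rh|exact: rf].
Qed.

End correlation_radial.

(** * Strict monotonicity of the kernel *)

Lemma radial_periodic_constant f (e : R) : radially_nonincreasing f -> (0 < e)%R ->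
  (forall p : R, (0 < p)%R -> f (p + e)%R = f p) ->
  forall x, x != 0%R -> f x = f 1%R.
Proof.
move=> rf e0 fe.
have fn (p : R) n : (0 < p)%R -> f (p + e *+ n)%R = f p.
  move=> p0; elim: n => [|n <-]; first by rewrite mulr0n addr0.
  by rewrite mulrSr addrA fe// ltr_wpDr// mulrn_wge0// ltW.
have fle (p q : R) : (0 < p)%R -> (0 < q)%R -> f p <= f q.
  move=> p0 q0; rewrite -(fn p (Num.truncn (q / e)).+1)//; apply: rf.
  have qn : (q <= e *+ (Num.truncn (q / e)).+1)%R.
    rewrite -mulr_natr mulrC -ler_pdivrMr//; exact/ltW/Num.Theory.truncnS_gt.
  rewrite !gtr0_norm//; first by rewrite (le_trans qn)// lerDr ltW.
  by rewrite ltr_wpDr// mulrn_wge0// ltW.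
move=> x x0; have nx : (0 < `|x|)%R by rewrite normr_gt0.
have -> : f x = f `|x|%R by apply/eqP; rewrite eq_le !rf// normr_id.
by apply/eqP; rewrite eq_le !fle.
Qed.

(** If the kernel had equal values at [y] and [z], the folded difference would
    have integral zero, so [f (x - y)] and [f (x - z)] would agree for almost
    every [x] on the side of [y].  Between these two arguments, up to sign, [f]
    would be constant, over a distance [z - y].  The exceptional null set costs
    half of that distance: [f] would have period [(z - y) / 2] on the whole
    positive half-line, and would therefore be constant there. *)
Lemma correlation_strict f (k : R -> R) (y z : R) :
  radially_nonincreasing f -> (forall x, 0 <= f x) ->
  (forall x, x != 0%R -> f x \is a fin_num) ->
  ~ (forall x, x != 0%R -> f x = f 1%R) ->
  (forall x, (0 <= k x)%R) -> radially_nonincreasing (EFin \o k) ->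
  (forall x x', (`|x| < `|x'|)%R -> (k x' < k x)%R) ->
  (0 <= y)%R -> (y < z)%R -> correlation (EFin \o k) f z \is a fin_num ->
  correlation (EFin \o k) f z < correlation (EFin \o k) f y.
Proof.
move=> rf f0 ffin fncst k0 rh kstrict y0 yz Kfin.
set h := EFin \o k in rh Kfin *.
have h0 x : 0 <= h x by rewrite lee_fin.
have mf := radial_measurable rf; have mh := radial_measurable rh.
have Kle : correlation h f z <= correlation h f y.
  by apply: correlation_radial => //; rewrite !ger0_norm// ltW// (le_lt_trans y0).
rewrite lt_neqAle Kle andbT; apply/eqP => Keq; apply: fncst.
set m := ((y + z) / 2)%R.
pose D x := (h x - h (y + z - x)%R) * (f (x - y)%R - f (x - z)%R).
have mD : measurable_fun [set: R] D.
  apply: emeasurable_funM; apply: emeasurable_funB => //.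
  - exact: measurableT_comp mh (measurable_subrl (y + z)%R).
  - exact: measurable_shift mf.
  - exact: measurable_shift mf.
have xz0 x : (x < m)%R -> (x - z != 0)%R by rewrite /m => xm; rewrite lt_eqF//; lra.
have D0 x : (x < m)%R -> 0 <= D x.
  move=> xm; have [/ltW xyz /ltW xs] := fold_dist y0 yz xm.
  rewrite mule_ge0// sube_ge0 ?rh ?rf//.
  by rewrite ffin ?xz0.
have iD : \int[mu]_(x in `]-oo, m[) D x = 0.
  have : correlation h f y = correlation h f z + \int[mu]_(x in `]-oo, m[) D x.
    rewrite (correlation_fold rf rh f0 h0 z y) (correlation_fold rf rh f0 h0 y z).
    rewrite (addrC z y) -ge0_integralD//.
    - apply: eq_integral => x; rewrite inE /= in_itv /= => xm.
      have [/ltW xyz /ltW xs] := fold_dist y0 yz xm.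
      by rewrite two_point_identity ?ffin ?xz0 ?rh ?rf.
    - by move=> x _; rewrite adde_ge0 ?mule_ge0.
    - by apply: measurable_funTS; exact: measurable_folded.
    - exact: measurable_funTS.
  rewrite -Keq; move: Kfin; case: (correlation h f z) => // r _.
  have : 0 <= \int[mu]_(x in `]-oo, m[) D x.
    by apply: integral_ge0 => x; exact: D0.
  case: (\int[mu]_(x in _) _) => // s _ [/eqP].
  by rewrite -subr_eq0 opprD addrA subrr sub0r oppr_eq0 => /eqP ->.
have aeD : {ae mu, forall x, `]-oo, m[%classic x -> D x = 0}.
  by apply: ge0_integral0_ae => //; exact: measurable_funTS.
pose d := (z - y)%R.
have d0 : (0 < d / 2)%R by rewrite /d; lra.
apply: (radial_periodic_constant rf d0) => p p0.
(* A point x with 0 < y - x < p and p + d / 2 < z - x, so that [p, p + d / 2]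
   lies inside [y - x, z - x]. *)
have /(ae_itvoo_ex aeD)[x [xp]] : (y - p < Num.min y (y - p + d / 2))%R.
  by rewrite lt_min; apply/andP; split; lra.
rewrite lt_min => /andP[xy xpd] Dx.
have xm : (x < m)%R by rewrite /m; lra.
have [xyz xs] := fold_dist y0 yz xm.
have fxyz : f (x - y)%R = f (x - z)%R.
  have /eqP : D x = 0 by apply: Dx; rewrite /= in_itv.
  rewrite mule_eq0 /h /= -EFinB eqe subr_eq0 gt_eqF ?kstrict//=.
  by move=> /eqP fxy; rewrite -[LHS](@subeK _ _ (f (x - z)%R)) ?ffin ?xz0// fxy add0e.
rewrite /d in xpd d0 *.
apply/eqP; rewrite eq_le; apply/andP; split.
  by apply: rf; rewrite (@gtr0_norm _ p)// gtr0_norm; lra.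
apply: (@le_trans _ _ (f (x - y)%R)).
  by apply: rf; rewrite (@gtr0_norm _ p)// (@ltr0_norm _ (x - y)%R); lra.
rewrite fxyz; apply: rf.
rewrite (@gtr0_norm _ (p + _)%R); last by lra.
by rewrite (@ltr0_norm _ (x - z)%R); lra.
Qed.

(** * The bathtub principle *)

Lemma M1E x : @M1 R x = if (`|x| < 2^-1)%R then 1 else 0.
Proof. by rewrite /M1 indicE mem_setE in_itv/= -ltr_norml; case: ifP. Qed.

Lemma M1_ge0 x : 0 <= @M1 R x.
Proof. by rewrite M1E; case: ifP. Qed.

Lemma measurable_M1 : measurable_fun [set: R] (@M1 R).
Proof. by apply/measurable_EFinP; exact: measurable_indic. Qed.

Lemma integral_M1 : \int[mu]_x @M1 R x = 1.
Proof.
rewrite /M1 integral_indic// setIT /= lebesgue_measure_itv/= lte_fin.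
rewrite ifT; last by lra.
by rewrite -EFinB; congr EFin; lra.
Qed.

(** Where [M1 = 1], both [1 - g] and [K - c] are nonnegative; where [M1 = 0],
    both [g] and [c - K] are.  So [|M1 - g| |K - c| = (M1 - g) (K - c)]
    everywhere, and [c] drops out because [g] and [M1] have the same mass. *)
Lemma bathtub_identity g (K : R -> \bar R) (c : R) :
  measurable_fun [set: R] g -> (forall x, 0 <= g x <= 1) ->
  \int[mu]_x g x = 1 ->
  measurable_fun [set: R] K -> (forall x, 0 <= K x) ->
  (forall x, (`|x| < 2^-1)%R -> c%:E <= K x) ->
  (forall x, (2^-1 <= `|x|)%R -> K x <= c%:E) ->
  \int[mu]_x (g x * K x) + \int[mu]_x (`|M1 x - g x| * `|K x - c%:E|) =
  \int[mu]_x (M1 x * K x).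
Proof.
move=> mg g01 ig mK K0 Kin Kout.
have g0 x : 0 <= g x by case/andP: (g01 x).
have c0 : (0 <= c)%R.
  by rewrite -lee_fin; apply: le_trans (K0 2^-1%R) (Kout _ _); exact: ler_norm.
have mM1 := measurable_M1.
pose dev x := `|M1 x - g x| * `|K x - c%:E|.
have mdev : measurable_fun [set: R] dev.
  by apply: emeasurable_funM; apply: measurableT_comp => //; exact: emeasurable_funB.
have dev0 x : 0 <= dev x by rewrite mule_ge0.
(* The terms with c stand on the side where they are added, so that the equation
   also holds where K is infinite. *)
have pointwise x : (g x * K x + dev x) + M1 x * c%:E = M1 x * K x + g x * c%:E.
  rewrite /dev M1E; have gfin : g x \is a fin_num.
    by rewrite ge0_fin_numE//; case/andP: (g01 x) => _ /le_lt_trans; apply; rewrite ltry.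
  case/andP: (g01 x); case: (g x) gfin => // r _; rewrite !lee_fin => r0 r1.
  case: ltP => [/Kin cK|/Kout Kc].
    move: cK; case: (K x) => [k|_|//].
      rewrite lee_fin => ck; rewrite !mul1e/= !ger0_norm ?subr_ge0//.
      by rewrite -!EFinM -!EFinD; congr EFin; ring.
    rewrite !mul1e /= -EFinM addye//.
    have [->|r_neq0] := eqVneq r 0%R; first by rewrite mul0e add0e subr0 normr1 mul1e.
    have r_gt0 : (0 < r)%R by rewrite lt_neqAle eq_sym r_neq0.
    by rewrite gt0_muley// addye// gt_eqF// (lt_le_trans (ltNyr 0))// mule_ge0.
  have kfin : K x \is a fin_num by rewrite ge0_fin_numE// (le_lt_trans Kc)// ltry.
  move: Kc; case: (K x) kfin => // k _.
  rewrite lee_fin => kc; rewrite !mul0e sub0e/= normrN ger0_norm// ler0_norm ?subr_le0//.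
  by rewrite -!EFinM -!EFinD ?adde0 ?add0e -?EFinD; congr EFin; ring.
have : \int[mu]_x ((g x * K x + dev x) + M1 x * c%:E) =
    \int[mu]_x (M1 x * K x + g x * c%:E).
  by apply: eq_integral => x _; exact: pointwise.
have mgK : measurable_fun [set: R] (fun x => g x * K x) by exact: emeasurable_funM.
have mMK : measurable_fun [set: R] (fun x => M1 x * K x) by exact: emeasurable_funM.
have mc : measurable_fun [set: R] (fun=> c%:E) by [].
rewrite ge0_integralD//; last 4 first.
- by move=> x _; rewrite adde_ge0 ?mule_ge0.
- exact: emeasurable_funD.
- by move=> x _; rewrite mule_ge0 ?M1_ge0 ?lee_fin.
- exact: emeasurable_funM.
rewrite ge0_integralD//; last by move=> x _; rewrite mule_ge0.
rewrite ge0_integralD//; last 3 first.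
- by move=> x _; rewrite mule_ge0 ?M1_ge0.
- by move=> x _; rewrite mule_ge0 ?lee_fin.
- exact: emeasurable_funM.
rewrite !ge0_integralZr ?lee_fin//; last by move=> x _; exact: M1_ge0.
rewrite integral_M1 ig mul1e => /(congr1 (fun t => t - c%:E)).
by rewrite !addeK.
Qed.

(** When [K (1/2)] is infinite the identity makes no sense, but then [K] is
    infinite on the support of [M1] and the right-hand side is [+oo]. *)
Lemma bathtub_le g (K : R -> \bar R) :
  measurable_fun [set: R] g -> (forall x, 0 <= g x <= 1) ->
  \int[mu]_x g x = 1 ->
  radially_nonincreasing K -> (forall x, 0 <= K x) ->
  \int[mu]_x (g x * K x) <= \int[mu]_x (M1 x * K x).
Proof.
move=> mg g01 ig rK K0; have mK := radial_measurable rK.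
have half : `|2^-1%R : R|%R = 2^-1%R by rewrite gtr0_norm.
have Kin x : (`|x| < 2^-1)%R -> K 2^-1%R <= K x.
  by move=> /ltW xh; apply: rK; rewrite half.
have Kout x : (2^-1 <= `|x|)%R -> K x <= K 2^-1%R.
  by move=> xh; apply: rK; rewrite half.
have := K0 2^-1%R; case Ec : (K 2^-1%R) => [c| |] // _.
  rewrite Ec in Kin Kout.
  rewrite -(bathtub_identity mg g01 ig mK K0 Kin Kout) leeDl//.
  by apply: integral_ge0 => x _; rewrite mule_ge0.
rewrite (_ : \int[mu]_x (M1 x * K x) = +oo) ?leey//.
transitivity (\int[mu]_x (M1 x * +oo)).
  apply: eq_integral => x _; rewrite M1E; case: ltP => [/Kin|]; last by rewrite !mul0e.
  by rewrite Ec leye_eq => /eqP ->.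
rewrite ge0_integralZr//; first by rewrite integral_M1 mul1e.
- exact: measurable_M1.
- by move=> x _; exact: M1_ge0.
Qed.

(** By the identity, equality makes the integral of [|M1 - g| |K - c|] vanish,
    and strictness makes [|K - c|] positive away from [1/2] and [-1/2]. *)
Lemma bathtub_eq g (K : R -> \bar R) :
  measurable_fun [set: R] g -> (forall x, 0 <= g x <= 1) ->
  \int[mu]_x g x = 1 ->
  radially_nonincreasing K -> (forall x, 0 <= K x) ->
  (forall y z : R, (0 <= y)%R -> (y < z)%R -> K z < K y) ->
  K 2^-1%R \is a fin_num -> \int[mu]_x (M1 x * K x) \is a fin_num ->
  \int[mu]_x (g x * K x) = \int[mu]_x (M1 x * K x) ->
  {ae mu, forall x, g x = M1 x}.
Proof.
move=> mg g01 ig rK K0 Kstrict; have mK := radial_measurable rK.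
have Kabs x : K x = K `|x|%R by case: (ger0P x) => // _; rewrite radialN.
have Kin x : (`|x| < 2^-1)%R -> K 2^-1%R < K x by rewrite (Kabs x); exact: Kstrict.
have Kout x : (2^-1 < `|x|)%R -> K x < K 2^-1%R.
  by rewrite (Kabs x); apply: Kstrict.
case Ec : (K 2^-1%R) Kin Kout => [c| |] // Kin Kout _ ifin Keq.
have mdev : measurable_fun [set: R] (fun x => `|M1 x - g x| * `|K x - c%:E|).
  have mM1 := measurable_M1.
  by apply: emeasurable_funM; apply: measurableT_comp => //; exact: emeasurable_funB.
have idev : \int[mu]_x (`|M1 x - g x| * `|K x - c%:E|) = 0.
  have id := bathtub_identity mg g01 ig mK K0 (fun x xh => ltW (Kin x xh)) (c := c).
  have {id} : \int[mu]_x (g x * K x) + \int[mu]_x (`|M1 x - g x| * `|K x - c%:E|) =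
      \int[mu]_x (M1 x * K x).
    apply: id => x; rewrite le_eqVlt => /predU1P[xh|/Kout/ltW//].
    by rewrite (Kabs x) -xh Ec.
  rewrite Keq => /(congr1 (fun t => t - \int[mu]_x (M1 x * K x))).
  by rewrite subee// addeAC subee// add0e.
have := ge0_integral0_ae measurableT mdev _ idev.
move=> /(_ (fun x _ => mule_ge0 (abse_ge0 _) (abse_ge0 _))) aedev.
have := ae_neq (2^-1%R : R); have := ae_neq (- 2^-1%R : R)%R.
move: aedev; apply: (filterS3 filter_ae_lebesgue) => x /(_ I) /eqP.
rewrite mule_eq0 !abse_eq0.
move=> /orP[|Kc xN xP].
  have gfin : g x \is a fin_num.
    have /andP[g0 g1] := g01 x.
    by rewrite ge0_fin_numE// (le_lt_trans g1)// ltry.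
  move=> /eqP Mg _ _.
  by rewrite -[RHS](@subeK _ _ (g x))// Mg add0e.
have {}Kc : K x = c%:E by rewrite -[LHS](@subeK _ _ c%:E)// (eqP Kc) add0e.
have [/Kin|/Kout|xh] := ltgtP `|x|%R 2^-1%R.
- by rewrite Kc ltxx.
- by rewrite Kc ltxx.
- by move/eqP: xh; rewrite eqr_norml (negbTE xN) (negbTE xP).
Qed.

(** Translation invariance: [x |-> y - x] turns [f (x - y)] into [f (- x)]. *)
Lemma correlation_cst1 f y : radially_nonincreasing f -> (forall x, 0 <= f x) ->
  correlation (cst 1) f y = \int[mu]_x f x.
Proof.
move=> rf f0; have mf := radial_measurable rf.
rewrite /correlation (ge0_integral_reflect y)//.
- rewrite preimage_setT; apply: eq_integral => x _.
  by rewrite mul1e -(radialN rf); congr f; lra.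
- by apply: emeasurable_funM => //; exact: measurable_shift.
- by move=> x; rewrite mul1e.
Qed.

(** * A strictly decreasing weight, and the theorem *)

Definition decay x : R := (1 + `|x|)^-1.

Let decay_den_gt0 x : (0 < 1 + `|x|)%R.
Proof. by rewrite ltr_wpDr. Qed.

Lemma decay_gt0 x : (0 < decay x)%R.
Proof. by rewrite invr_gt0. Qed.

Lemma decay_le1 x : (decay x <= 1)%R.
Proof. by rewrite invf_le1// lerDl. Qed.

Lemma decay_strict x x' : (`|x| < `|x'|)%R -> (decay x' < decay x)%R.
Proof. by move=> xx'; rewrite ltf_pV2 ?posrE// ltrD2l. Qed.

Lemma decay_radial : radially_nonincreasing (EFin \o decay).
Proof. by move=> x x' xx'; rewrite lee_fin lef_pV2 ?posrE// lerD2l. Qed.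

End radial.

Theorem theorem3p1 (R : realType) (f g : R -> \bar R)
    (hf : symmetrically_decreasing f)
    (hg : symmetrically_decreasing g)
    (hg01 : forall x : R, 0 <= g x <= 1)
    (hg1 : \int[lebesgue_measure]_(x in setT) g x = 1) :
  (forall h : R -> \bar R, symmetrically_decreasing h ->
    \int[lebesgue_measure]_(x in setT) (h x * convolution f g x) <=
    \int[lebesgue_measure]_(x in setT) (h x * convolution f (@M1 R) x)) /\
  (~ ae_constant f ->
   lebesgue_measure.-integrable setT (convolution f g) ->
   (forall h : R -> \bar R, symmetrically_decreasing h ->
     \int[lebesgue_measure]_(x in setT) (h x * convolution f g x) =
     \int[lebesgue_measure]_(x in setT) (h x * convolution f (@M1 R) x)) ->
   {ae lebesgue_measure, forall x : R, g x = M1 x}).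
Proof.
have mg := symmetrically_decreasing_measurable hg.
have mM1 := @measurable_M1 R.
have [f0 _ _] := hf; have [g0 _ _] := hg.
rewrite (convolution_raise0 hf mg) (convolution_raise0 hf mM1).
have rF := raise0_radial hf; have F0 := raise0_ge0 f0.
have F_eq x : x != 0%R -> raise0 f x = f x by exact: raise0_eq.
move: (raise0 f) rF F0 F_eq => F rF F0 F_eq.
have mF := radial_measurable rF.
have pair h u : measurable_fun [set: R] h -> (forall x, 0 <= h x) ->
    measurable_fun [set: R] u -> (forall x, 0 <= u x) ->
    \int[lebesgue_measure]_x (h x * convolution F u x) =
    \int[lebesgue_measure]_y (u y * correlation h F y).
  by move=> mh h0 mesu u0; exact: integral_mul_convolution.
split.
  move=> h hh; have [h0 _ _] := hh.
  have rh := raise0_radial hh; have H0 := raise0_ge0 h0.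
  have raise_h u : measurable_fun [set: R] u -> (forall x, 0 <= u x) ->
      \int[lebesgue_measure]_x (h x * convolution F u x) =
      \int[lebesgue_measure]_x (raise0 h x * convolution F u x).
    move=> mesu u0; have mFu := measurable_convolution mF mesu F0 u0.
    apply: (integral_eq_off_point (p := 0%R)).
    - by apply: emeasurable_funM => //; exact: symmetrically_decreasing_measurable.
    - by apply: emeasurable_funM => //; exact: radial_measurable.
    - by move=> x x0; rewrite raise0_eq.
  have mH := radial_measurable rh.
  rewrite !raise_h ?pair//; try exact: M1_ge0.
  apply: bathtub_le => //; first exact: correlation_radial.
  exact: correlation_ge0.
move=> fncst intFg heq.
(* The constant weight 1 has constant kernel, the integral of F. *)
have iF0 : 0 <= \int[lebesgue_measure]_x F x by apply: integral_ge0 => x _.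
have iF : \int[lebesgue_measure]_x F x < +oo.
  have /integrableP[_] := intFg.
  rewrite (_ : \int[_]_x _ = \int[lebesgue_measure]_x F x)//.
  transitivity (\int[lebesgue_measure]_x (cst 1 x * convolution F g x)).
    apply: eq_integral => x _; rewrite mul1e gee0_abs//; exact: convolution_ge0.
  rewrite pair//; under eq_integral do rewrite correlation_cst1//.
  by rewrite ge0_integralZr// hg1 mul1e.
have Ffin0 x : x != 0%R -> F x \is a fin_num.
  move=> x0; have intF : lebesgue_measure.-integrable [set: R] F.
    apply/integrableP; split => //.
    by under eq_integral do rewrite gee0_abs//.
  have x_gt0 : (0 < `|x|)%R by rewrite normr_gt0.
  have [t [t0 tx /(_ I) Ft]] := ae_itvoo_ex (integrable_ae measurableT intF) x_gt0.
  rewrite ge0_fin_numE//; apply: (@le_lt_trans _ _ (F t)).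
    by apply: rF; rewrite (gtr0_norm t0) ltW.
  by rewrite -ge0_fin_numE.
have Fncst : ~ (forall x, x != 0%R -> F x = F 1%R).
  move=> Fcst; apply: fncst; exists (F 1%R).
  apply: (@filterS _ _ filter_ae_lebesgue _ _ _ (ae_neq (0%R : R))) => x x0.
  by rewrite -F_eq ?Fcst.
set h : R -> \bar R := EFin \o (@decay R).
have rh : radially_nonincreasing h by exact: decay_radial.
have h0 x : 0 <= h x by rewrite lee_fin ltW// decay_gt0.
have mh := radial_measurable rh.
have hh : symmetrically_decreasing h.
  split => //; first exact: radialN.
  by move=> x y x0 xy; apply: rh; rewrite !gtr0_norm ?ltW// (lt_trans x0).
pose K := correlation h F.
have K0 y : 0 <= K y by exact: correlation_ge0.
have rK : radially_nonincreasing K by exact: correlation_radial.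
have mK := radial_measurable rK.
have K_le y : K y <= \int[lebesgue_measure]_x F x.
  rewrite -(correlation_cst1 y rF F0); apply: ge0_le_integral => //.
  - by move=> x _; rewrite mule_ge0.
  - by apply: emeasurable_funM => //; exact: measurable_shift.
  - by apply: emeasurable_funM => //; exact: measurable_shift.
  - by move=> x _; rewrite lee_wpmul2r// lee_fin decay_le1.
have Kfin y : K y \is a fin_num.
  by rewrite ge0_fin_numE// (le_lt_trans (K_le y)).
have M10 := @M1_ge0 R.
apply: (bathtub_eq mg hg01 hg1 rK K0) => //.
- by move=> y z y0 yz; apply: correlation_strict => //; exact: decay_strict.
- have iMK0 : 0 <= \int[lebesgue_measure]_x (M1 x * K x).
    by apply: integral_ge0 => x _; rewrite mule_ge0.
  rewrite ge0_fin_numE//; apply: le_lt_trans iF.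
  rewrite -[leRHS]mul1e -[X in X * _](@integral_M1 R) -ge0_integralZr//.
  apply: ge0_le_integral => //.
  + by move=> x _; rewrite mule_ge0.
  + exact: emeasurable_funM.
  + exact: emeasurable_funM.
  + by move=> x _; rewrite lee_wpmul2l.
- by rewrite -!pair//; exact: heq.
Qed.
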